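(* Let $n\ge1$, let $M\le N$ be integers and let $0\le s\le n$. Let $\mathcal P_s$ be the set of pure diagrams lying in $B_{M,N}$ of codimension at least $s$. Then the simplicial fan of pure diagrams in $B^s_{M,N}$, i.e. the union over all chains $C\subseteq\mathcal P_s$ of the cones $\{\sum_{\pi\in C}\lambda_\pi\pi:\lambda_\pi\ge 0\}$, is a convex subset of $B^s_{M,N}$.
   Context: $B_{M,N}$ is the $\mathbb Q$-vector space of arrays $\beta=(\beta_{i,j})$ indexed by $0\le i\le n$, $j\in\mathbb Z$, with $\beta_{i,j}=0$ unless $M+i\le j\le N+i$. $B^s_{M,N}$ is the subspace of $\beta$ satisfying $\sum_{i=0}^n\sum_j(-1)^i\beta_{i,j}j^m=0$ for $m=0,\dots,s-1$. For integers $d_0<d_1<\dots<d_t$ with $0\le t\le n$, the pure diagram $\pi(d_0,\dots,d_t)$ is the array whose entry in position $(i,d_i)$ is $(-1)^i\prod_{0\le j\le t,\,j\ne i}\frac{1}{d_j-d_i}$ for $i=0,\dots,t$, and whose other entries are $0$; its codimension is $t$. It lies in $B_{M,N}$ iff $M+i\le d_i\le N+i$ for all $i$. Partial order: $\pi(d_0,\dots,d_t)\le\pi(d'_0,\dots,d'_u)$ iff $t\ge u$ and $d_i\le d'_i$ for $i=0,\dots,u$. A chain is a totally ordered subset. *)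

(* Defs.v *)
From HB Require Import structures.
From mathcomp Require Import all_boot all_order all_algebra.
Set Implicit Arguments. Unset Strict Implicit. Unset Printing Implicit Defensive.
Import Order.TTheory GRing.Theory Num.Theory.
Local Open Scope ring_scope.

Definition diagram := nat -> int -> rat.

Definition inB (n : nat) (M N : int) (beta : diagram) : Prop :=
  forall (i : nat) (j : int), beta i j != 0 ->
    (i <= n)%N /\ M + i%:Z <= j <= N + i%:Z.

(* Sum over all j in Z of beta_{i,j} j^m, for beta in B_{M,N} with M <= N:
   the support in row i is contained in j = M+i+k, 0 <= k <= N-M. *)
Definition rowsum (M N : int) (beta : diagram) (i m : nat) : rat :=
  \sum_(k < (absz (N - M)).+1)
     beta i (M + i%:Z + k%:Z) * ((M + i%:Z + k%:Z)%:~R) ^+ m.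

(* B^s_{M,N}: the Herzog--Kuehl-type equations for m = 0,...,s-1. *)
Definition inBs (n : nat) (M N : int) (s : nat) (beta : diagram) : Prop :=
  inB n M N beta /\
  forall m : nat, (m < s)%N ->
    \sum_(i < n.+1) (-1) ^+ i * rowsum M N beta i m = 0.

(* Degree sequences d = (d_0 < ... < d_t), represented as seq int. *)
Definition pure (d : seq int) : diagram :=
  fun i j =>
    if (i < size d)%N && (j == nth 0 d i) then
      (-1) ^+ i * \prod_(k < size d | (k : nat) != i)
                    ((nth 0 d k - nth 0 d i)%:~R)^-1
    else 0.

Definition codim (d : seq int) : nat := (size d).-1.

Definition degseq (n : nat) (d : seq int) : Prop :=
  sorted <%R d /\ (0 < size d)%N /\ (size d <= n.+1)%N.

Definition deg_inB (M N : int) (d : seq int) : Prop :=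
  forall i : nat, (i < size d)%N -> M + i%:Z <= nth 0 d i <= N + i%:Z.

Definition in_Ps (n : nat) (M N : int) (s : nat) (d : seq int) : Prop :=
  degseq n d /\ deg_inB M N d /\ (s <= codim d)%N.

Definition pure_le (d d' : seq int) : Prop :=
  (size d' <= size d)%N /\
  forall i : nat, (i < size d')%N -> nth 0 d i <= nth 0 d' i.

Definition chain_Ps (n : nat) (M N : int) (s : nat) (C : seq (seq int)) : Prop :=
  (forall d, d \in C -> in_Ps n M N s d) /\
  (forall d d', d \in C -> d' \in C -> pure_le d d' \/ pure_le d' d).

Definition fan (n : nat) (M N : int) (s : nat) (beta : diagram) : Prop :=
  exists C : seq (seq int), chain_Ps n M N s C /\
  exists lam : seq int -> rat, (forall d, d \in C -> 0 <= lam d) /\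
    beta = (fun i j => \sum_(d <- undup C) lam d * pure d i j).

(* Main.v *)
From Stdlib Require Import FunctionalExtensionality.
Require Import Defs.
From HB Require Import structures.
From mathcomp Require Import all_boot all_order all_algebra.
From mathcomp Require Import zify ring lra.
Import Order.TTheory GRing.Theory Num.Theory.
Local Open Scope ring_scope.
Set Implicit Arguments. Unset Strict Implicit. Unset Printing Implicit Defensive.

(* Up to the signs (-1)^i, the entries of pi(d) are the weights of the divided
   difference at d_0 < ... < d_t. A positive combination beta of pure diagrams
   is decomposed greedily along an ascending chain of degree sequences: subtract
   the largest multiple of the current pure diagram that keeps the entries of
   all raisable rows nonnegative, and raise a row whose entry has vanished. The
   only obstruction is a row k freed by raising row k + 1 from e_k + 1: its
   entry is, up to a positive factor, the value of a linear form that vanishes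
   on all pure diagrams below and is nonnegative on every pure diagram. This
   positivity is a statement on divided differences of a truncated product of
   linear factors, proved by removing one root at a time. Codimension below s
   needs no separate treatment: the equations defining B^s kill the coefficients
   of small codimension, since the moment of order v does not vanish in
   codimension v. *)

(** * Divided differences over finite sets of integers *)

Definition dd_weight (c : seq int) (x : int) : rat :=
  \prod_(y <- c | y != x) ((y - x)%:~R)^-1.

(** For duplicate-free [c] this is the usual divided difference at the nodes [c] times
    (-1)^([size c] - 1), because the weights use [y - x]. The same orientation [r - x] in
    [root_poly] makes the signs cancel in top degree. *)
Definition dd (f : int -> rat) (c : seq int) : rat :=
  \sum_(x <- c) f x * dd_weight c x.

Definition root_poly (R : seq int) (x : int) : rat :=
  \prod_(r <- R) (r - x)%:~R.

(* For [x] in a duplicate-free [s], this is the index of [x] in the increasing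
   enumeration of [s]; it replaces row indices and makes order immaterial. *)
Definition below (x : int) (s : seq int) : nat := count (fun y => y < x) s.

Lemma perm_dd_weight (c c' : seq int) : perm_eq c c' -> dd_weight c =1 dd_weight c'.
Proof. by move=> cc' x; exact: perm_big. Qed.

Lemma perm_dd f (c c' : seq int) : perm_eq c c' -> dd f c = dd f c'.
Proof.
move=> cc'; rewrite /dd (perm_big _ cc').
by apply: eq_bigr => x _; rewrite (perm_dd_weight cc').
Qed.

Lemma perm_below x (s s' : seq int) : perm_eq s s' -> below x s = below x s'.
Proof. by move/permP; apply. Qed.

Lemma eq_dd (c : seq int) f g : {in c, f =1 g} -> dd f c = dd g c.
Proof. by move=> fg; apply: eq_big_seq => x xc; rewrite fg. Qed.

Lemma ddD f g c : dd (fun x => f x + g x) c = dd f c + dd g c.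
Proof. by rewrite /dd -big_split; apply: eq_bigr => x _; rewrite mulrDl. Qed.

Lemma ddZ a f c : dd (fun x => a * f x) c = a * dd f c.
Proof. by rewrite /dd big_distrr; apply: eq_bigr => x _ /=; rewrite mulrA. Qed.

Lemma dd_weight_cons z c x : x != z ->
  dd_weight (z :: c) x = ((z - x)%:~R)^-1 * dd_weight c x.
Proof. by rewrite /dd_weight big_cons eq_sym => ->. Qed.

(** Leibniz rule for a linear factor: split [r - x] as [(r - z) + (z - x)]; the second summand
    cancels the node [z] from every weight. *)
Lemma dd_mul_linear (r z : int) (q : int -> rat) (c : seq int) : uniq (z :: c) ->
  dd (fun x => (r - x)%:~R * q x) (z :: c) =
  (r - z)%:~R * dd q (z :: c) + dd q c.
Proof.
case/andP=> zc _; rewrite /dd !big_cons mulrDr -addrA !mulrA; congr (_ + _).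
rewrite big_distrr -big_split; apply: eq_big_seq => x xc /=.
have xz : x != z by apply: contraNneq zc => <-.
have nz : (z - x)%:~R != 0 :> rat by rewrite intr_eq0 subr_eq0 eq_sym.
rewrite dd_weight_cons //.
have -> : (r - x)%:~R = (r - z)%:~R + (z - x)%:~R :> rat by rewrite -rmorphD /=; congr _%:~R; ring.
by rewrite !mulrDl; congr (_ + _); rewrite ?mulrA //; rewrite (mulrC (z - x)%:~R) mulfK.
Qed.

Lemma dd_root (r : int) (q : int -> rat) (c : seq int) : uniq (r :: c) ->
  dd (fun x => (r - x)%:~R * q x) (r :: c) = dd q c.
Proof. by move=> /dd_mul_linear->; rewrite subrr mul0r add0r. Qed.

(** The recurrence of divided differences: [(z - x) * q x] is expanded once with [z] and once with
    [z'] as the leading node. *)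
Lemma dd_diff (z z' : int) (q : int -> rat) (c : seq int) : uniq [:: z, z' & c] ->
  (z - z')%:~R * dd q [:: z, z' & c] = dd q (z' :: c) - dd q (z :: c).
Proof.
move=> u; have p : perm_eq [:: z, z' & c] [:: z', z & c] by exact: (permEl (perm_catCA [:: z] [:: z'] c)).
have u' : uniq [:: z', z & c] by rewrite -(perm_uniq p).
have := perm_dd (fun x => (z - x)%:~R * q x) p.
rewrite (dd_root _ u) (dd_mul_linear _ _ u') (perm_dd q p) => ->.
by rewrite addrK.
Qed.

(** When [z <= r <= z'] both coefficients on the right are nonnegative, so a root between two nodes
    can be removed without losing the sign. *)
Lemma dd_interp (r z z' : int) (q : int -> rat) (c : seq int) : uniq [:: z, z' & c] ->
  (z' - z)%:~R * dd (fun x => (r - x)%:~R * q x) [:: z, z' & c] =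
  (z' - r)%:~R * dd q (z' :: c) + (r - z)%:~R * dd q (z :: c).
Proof.
move=> u; rewrite (dd_mul_linear _ _ u) mulrDr mulrCA.
rewrite -(opprB z z') rmorphN mulNr dd_diff // !rmorphB /=; ring.
Qed.

(** The divided difference reads off the top coefficient. The Leibniz rule trades each root for a
    node, since the term that keeps all nodes vanishes by degree. *)
Lemma dd_const_root_poly (R c : seq int) : uniq c -> (size R <= (size c).-1)%N -> (0 < size c)%N ->
  dd (root_poly R) c = (size R == (size c).-1)%:R.
Proof.
elim: R c => [|r R IH] c uc sR c0.
  have -> : dd (root_poly [::]) c = dd (fun=> 1) c.
    by apply: eq_dd => x _; rewrite /root_poly big_nil.
  move: uc c0 {sR}; have [m] := ubnP (size c).
  elim: m c => // m IH [//|z [|z' c]] sc uc _.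
    by rewrite /dd big_seq1 /dd_weight big_cons eqxx big_nil /= mulr1.
  have nz : (z - z')%:~R != 0 :> rat.
    by move: uc; rewrite /= inE negb_or intr_eq0 subr_eq0 -andbA => /andP[].
  apply/(mulfI nz); rewrite mulr0 dd_diff // !IH ?subrr //=; last first.
  - by case/andP: uc.
  - by move: uc; rewrite /= inE negb_or -!andbA => /and4P[_ -> _ ->].
case: c uc sR c0 => // z c uc /= sR _.
have -> : dd (root_poly (r :: R)) (z :: c) = dd (fun x => (r - x)%:~R * root_poly R x) (z :: c).
  by apply: eq_dd => x _; rewrite /root_poly big_cons.
have u' : uniq c by case/andP: uc.
rewrite dd_mul_linear // (IH (z :: c)) ?(IH c) //=; first last.
- lia.
- lia.
- lia.
have -> : (size R == size c) = false by lia.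
have -> : (size R == (size c).-1) = ((size R).+1 == size c) by lia.
by rewrite mulr0 add0r.
Qed.

(** * Signs of divided differences of truncated products *)

Lemma seq_min (P : pred int) (c : seq int) : has P c ->
  exists z, [/\ z \in c, P z & {in c, forall x, P x -> z <= x}].
Proof.
elim: c => // y c IH; case: (boolP (has P c)) => [/IH[z [zc Pz mz]]|nP] /=.
- case: (boolP (P y && (y <= z))) => [/andP[Py yz]|nyz] _.
    exists y; split; rewrite ?inE ?eqxx // => x; rewrite inE => /predU1P[->//|xc Px].
    exact: le_trans yz (mz _ xc Px).
  exists z; split; rewrite ?inE ?zc ?orbT // => x; rewrite inE => /predU1P[->|xc] Px.
    by move: nyz; rewrite Px /= -ltNge => /ltW.
  exact: mz.
- rewrite (negbTE nP) orbF => Py; exists y; split; rewrite ?inE ?eqxx // => x.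
  rewrite inE => /predU1P[->//|xc Px]; case/hasP: nP; by exists x.
Qed.

Lemma seq_max (P : pred int) (c : seq int) : has P c ->
  exists z, [/\ z \in c, P z & {in c, forall x, P x -> x <= z}].
Proof.
move=> hP; have [|z [zc Pz mz]] := @seq_min (P \o -%R) (map -%R c).
  by rewrite has_map; apply: sub_has hP => x /=; rewrite opprK.
exists (- z); split=> //.
  by case/mapP: zc => y yc ->; rewrite opprK.
move=> x xc Px; rewrite lerNr; apply: mz; first exact: map_f.
by rewrite /= opprK.
Qed.

Lemma seq_extract (z : int) (c : seq int) : uniq c -> z \in c ->
  exists c', [/\ perm_eq c (z :: c'), uniq (z :: c') & {in c', forall x, x \in c /\ x != z}].
Proof.
move=> uc zc; have p := perm_to_rem zc; exists (rem z c).
split; rewrite -?(perm_uniq p) // => x; rewrite mem_rem_uniq // inE => /andP[xz xc]; by [].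
Qed.

(** Apply the recurrence at the two extreme points. Removing the largest point keeps all other
    ranks, removing the smallest lowers them by one, so the thresholds become [m] and [m - 1] and
    the two signed terms add up. *)
Lemma dd_tail_sign (m : nat) (c : seq int) : uniq c ->
  0 <= (-1) ^+ m * dd (fun x => (m <= below x c)%N%:R) c.
Proof.
have [l] := ubnP (size c); elim: l m c => // l IH m c sc uc.
case: (posnP m) => [->|m0].
  have [/size0nil ->|c0] := posnP (size c); first by rewrite /dd big_nil mulr0.
  have -> : dd (fun x => (0 <= below x c)%N%:R) c = dd (root_poly [::]) c.
    by apply: eq_dd => x _; rewrite /root_poly big_nil.
  by rewrite dd_const_root_poly // expr0 mul1r ler0n.
case: (leqP (size c) 1) => [c1|c1].
  rewrite [dd _ _](_ : _ = 0) ?mulr0 //; apply: big1_seq => x /andP[_ xc].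
  have -> : below x c = 0%N.
    apply/eqP; rewrite -leqn0 leqNgt -has_count; apply/hasPn => y yc.
    case: c xc yc c1 {sc uc} => [//|a [|//]]; rewrite !inE => /eqP-> /eqP->.
    by rewrite ltxx.
  by rewrite leqNgt m0 mul0r.
have [|z' [z'c _ mz']] := @seq_min predT c; first by rewrite has_predT; exact: ltnW.
have [c1' [p1 u1 sub1]] := seq_extract uc z'c.
have [|z [zc _ mz]] := @seq_max predT c1'.
  by rewrite has_predT; move: c1; rewrite (perm_size p1).
have [c' [p u sub]] := seq_extract (proj2 (andP u1)) zc.
have [zc0 zz'] := sub1 _ zc.
have lzz : z' < z by rewrite lt_neqAle eq_sym zz' mz'.
have pp : perm_eq c [:: z, z' & c'].
  apply: (perm_trans p1); rewrite (perm_trans (y := z' :: z :: c')) ?perm_cons //.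
  exact: (permEl (perm_catCA [:: z'] [:: z] c')).
have uu : uniq [:: z, z' & c'] by rewrite -(perm_uniq pp).
have zpos : 0 < (z - z')%:~R :> rat by rewrite ltr0z subr_gt0.
rewrite -(pmulr_rge0 _ zpos) mulrCA.
set f := fun x => _; rewrite (perm_dd f pp) dd_diff //.
have sz : (size c = (size c').+2)%N by rewrite (perm_size pp).
have u2 : uniq (z' :: c') by case/andP: uu.
have u3 : uniq (z :: c') by exact: u.
have E1 : dd f (z' :: c') = dd (fun x => (m <= below x (z' :: c'))%N%:R) (z' :: c').
  apply: eq_dd => x xc; rewrite /f (perm_below _ pp) /below /=.
  suff -> : (z < x) = false by [].
  apply/negbTE; rewrite -leNgt; move: xc; rewrite inE => /predU1P[->|xc]; first exact: ltW.
  by apply: mz => //; case: (sub _ xc).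
have E2 : dd f (z :: c') = dd (fun x => (m.-1 <= below x (z :: c'))%N%:R) (z :: c').
  apply: eq_dd => x xc; rewrite /f (perm_below _ pp) /below /=.
  suff -> : (z' < x) = true.
    by rewrite addnCA add1n -{1}(prednK m0) ltnS.
  have [xc1 xz'] : x \in c /\ x != z'.
    by apply: sub1; rewrite (perm_mem p).
  by rewrite lt_neqAle eq_sym xz' mz'.
have H1 := IH m (z' :: c') _ u2; have H2 := IH m.-1 (z :: c') _ u3.
rewrite E1 E2 mulrBr addr_ge0 //; first by apply: H1; move: sc; rewrite sz ltnS.
rewrite -{1}(prednK m0) exprS mulN1r mulNr opprK.
by apply: H2; move: sc; rewrite sz ltnS.
Qed.

Lemma below_lt (c : seq int) x y : x \in c -> x < y -> (below x c < below y c)%N.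
Proof.
elim: c => // z c IH; rewrite inE /below /= => /predU1P[<-|xc] xy.
  rewrite ltxx xy /= add0n add1n ltnS; apply: sub_count => w /= wx; exact: lt_trans wx xy.
have := IH xc xy; rewrite /below.
case: (ltrP z x) => [zx|_]; last by move=> H; rewrite add0n ltn_addl.
by rewrite (lt_trans zx xy) ltn_add2l.
Qed.

Lemma below_inj (c : seq int) : {in c &, injective (below^~ c)}.
Proof.
move=> x y xc yc /= e; case: (ltgtP x y) => // xy.
  by have := below_lt xc xy; rewrite e ltnn.
by have := below_lt yc xy; rewrite e ltnn.
Qed.

(** This is the case without roots: the rank must reach [h], [h + 1] or [h + 2] according to
    [x <= a], [x = a + 1] or [x > a + 1]. The ranks kept are all from [h], all from [h + 2], or all
    from [h] except [h + 1]. Keeping rank [h + 1] but not rank [h] would give the wrong sign; it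
    would need two points above [a] and at most [a + 1]. *)
Lemma dd_adjacent_sign (a : int) (h : nat) (c : seq int) : uniq c ->
  0 <= (-1) ^+ h * dd (fun x => ((a < x)%R + (a + 1 < x)%R + h <= below x c)%N%:R) c.
Proof.
move=> uc; set w := fun x => _.
pose S m := dd (fun x => (m <= below x c)%N%:R) c.
have S0 m : 0 <= (-1) ^+ m * S m by exact: dd_tail_sign.
case: (boolP (all (fun x => (below x c == h) ==> (x <= a)) c)) => [/allP A|].
  case: (boolP (all (fun x => (below x c == h.+1) ==> (x <= a + 1)) c)) => [/allP B|].
    suff -> : dd w c = S h by [].
    apply: eq_dd => x xc; rewrite /w; congr ((nat_of_bool _)%:R).
    have := A x xc; have := B x xc; lia.
  case/allPn => z zc; rewrite negb_imply => /andP[/eqP zh za].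
  have -> : dd w c = S h + (-1) * S h.+1 + S h.+2.
    rewrite /S -ddZ -!ddD; apply: eq_dd => x xc; rewrite /w.
    have [xz|xz] := eqVneq x z.
      rewrite xz zh; have -> : ((a < z)%R + (a + 1 < z)%R + h <= h.+1)%N = false by lia.
      by rewrite leqnSn leqnn ltnn.
    have nh : below x c != h.+1.
      by apply: contra xz => /eqP xh; apply/eqP; apply: (below_inj xc zc); rewrite xh zh.
    have := A x xc; case: (ltngtP (below x c) h.+1) nh => // xh _ Ax.
      have -> : ((a < x)%R + (a + 1 < x)%R + h <= below x c)%N = (h <= below x c)%N by lia.
      by rewrite mulr0 !addr0.
    have -> : ((a < x)%R + (a + 1 < x)%R + h <= below x c)%N by lia.
    have -> : (h <= below x c)%N by lia.
    by rewrite mulr1 subrr add0r.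
  have := S0 h; have := S0 h.+1; have := S0 h.+2.
  by rewrite !exprS !mulN1r opprK; lra.
case/allPn => z zc; rewrite negb_imply => /andP[/eqP zh za].
suff -> : dd w c = S h.+2 by have := S0 h.+2; rewrite !exprS !mulN1r opprK.
apply: eq_dd => x xc; rewrite /w; congr ((nat_of_bool _)%:R).
have [xz|xz] := eqVneq x z; first by rewrite xz zh; lia.
have nh : below x c != h.
  by apply: contra xz => /eqP xh; apply/eqP; apply: (below_inj xc zc); rewrite xh zh.
case: (ltrP x z) => zx; first by have := below_lt xc zx; lia.
lia.
Qed.

(** For increasing [E] and [c], [h = 0] and [x] the entry of [c] in a row [i < size E], this is the
    truncation [x <= nth 0 E i], stated by ranks alone. *)
Definition shifted_below (E c : seq int) (h : nat) (x : int) : bool :=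
  (below x E + h <= below x c)%N.

Lemma eq_dd_shifted (E E' c c0 : seq int) (h h' : nat) q :
  {in c, shifted_below E c0 h =1 shifted_below E' c h'} ->
  dd (fun x => (shifted_below E c0 h x)%:R * q x) c =
  dd (fun x => (shifted_below E' c h' x)%:R * q x) c.
Proof. by move=> H; apply: eq_dd => x xc; rewrite H. Qed.

Lemma shifted_below_cons r z E c h x : (r < x) = (z < x) ->
  shifted_below (r :: E) (z :: c) h x = shifted_below E c h x.
Proof. by rewrite /shifted_below /below /= => ->; lia. Qed.

Lemma shifted_below_perm E c c' h x : perm_eq c c' ->
  shifted_below E c h x = shifted_below E c' h x.
Proof. by move=> p; rewrite /shifted_below (perm_below _ p). Qed.

(* The shift [h] is needed for the induction: removing a root lying to the left
   of all points lowers every rank in the root sequence by one. *)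
Lemma dd_shifted_sign (a : int) (R c : seq int) (h : nat) : uniq c ->
  0 <= (-1) ^+ h *
    dd (fun x => (shifted_below (R ++ [:: a; a + 1]) c h x)%:R * root_poly R x) c.
Proof.
elim: R c h => [|r R IH] c h uc.
  rewrite [dd _ _](_ : _ = dd (fun x => ((a < x)%R + (a + 1 < x)%R + h <= below x c)%N%:R) c).
    exact: dd_adjacent_sign.
  by apply: eq_dd => x _; rewrite /root_poly big_nil mulr1 /shifted_below /below /= addn0.
have [->|c0] := eqVneq c [::]; first by rewrite /dd big_nil mulr0.
rewrite cat_cons; set E := R ++ _.
pose W (c : seq int) x := (shifted_below (r :: E) c h x)%:R * root_poly R x.
have -> : dd (fun x => (shifted_below (r :: E) c h x)%:R * root_poly (r :: R) x) c =
          dd (fun x => (r - x)%:~R * W c x) c.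
  by apply: eq_dd => x _; rewrite /W /root_poly big_cons mulrCA.
have WP c1 c2 f : perm_eq c1 c2 -> dd (fun x => f x * W c1 x) =1 dd (fun x => f x * W c2 x).
  by move=> p d; apply: eq_dd => x _; rewrite /W (shifted_below_perm _ _ _ p).
have W1P c1 c2 : perm_eq c1 c2 -> dd (W c1) =1 dd (W c2).
  by move=> p d; apply: eq_dd => x _; rewrite /W (shifted_below_perm _ _ _ p).
(* Dropping [z] from [c] together with [r] from the roots keeps the ranks,
   provided no other point separates [z] and [r]. *)
have drop z c' : uniq c' -> {in c', forall x, (r < x) = (z < x)} ->
    0 <= (-1) ^+ h * dd (W (z :: c')) c'.
  move=> uc' H; rewrite (eq_dd_shifted (E' := E) (h' := h)); first exact: IH.
  by move=> x xc; rewrite shifted_below_cons // H.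
have [rc|rc] := boolP (r \in c).
  have [c' [p u sub]] := seq_extract uc rc.
  rewrite (perm_dd _ p) (WP _ _ _ p) dd_root //.
  by apply: drop => //; case/andP: u.
have neq x : x \in c -> x != r by move=> xc; apply: contraNneq rc => <-.
(* If no point lies left of [r], the factor [r - z] at the least point [z] is negative; moving [r]
   from the rank sequence into the shift, [h.+1], supplies the missing sign. *)
have [hlt|hlt] := boolP (has (fun x => x < r) c); last first.
  have gtr x : x \in c -> r < x.
    move=> xc; rewrite lt_neqAle eq_sym neq //=; move/hasPn: hlt => /(_ x xc).
    by rewrite -leNgt.
  have [|z [zc _ mz]] := @seq_min predT c; first by rewrite has_predT lt0n size_eq0.
  have [c' [p u sub]] := seq_extract uc zc.
  rewrite (perm_dd _ p) (WP _ _ _ p) dd_mul_linear // mulrDr addr_ge0 //; last first.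
    apply: drop; first by case/andP: u.
    by move=> x /sub[xc xz]; rewrite gtr // lt_neqAle eq_sym xz mz.
  have -> d : (-1) ^+ h * ((r - z)%:~R * d) = (z - r)%:~R * ((-1) ^+ h.+1 * d) :> rat.
    by rewrite exprS !rmorphB /=; ring.
  apply: mulr_ge0; first by rewrite ler0z subr_ge0 ltW // gtr.
  rewrite /W (eq_dd_shifted (E' := E) (h' := h.+1)); first exact: IH.
  move=> x; rewrite -(perm_mem p) => xc; by rewrite /shifted_below /below /= gtr // add1n addSnnS.
have [z [zc zr mz]] := seq_max hlt.
have [c' [p u sub]] := seq_extract uc zc.
(* If no point lies right of [r], then [r] counts in no rank and is removed with [h] unchanged. *)
have [hgt|hgt] := boolP (has (fun x => r < x) c); last first.
  have ltr' x : x \in c -> x < r.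
    move=> xc; rewrite lt_neqAle neq //=; move/hasPn: hgt => /(_ x xc).
    by rewrite -leNgt.
  rewrite (perm_dd _ p) (WP _ _ _ p) dd_mul_linear // mulrDr addr_ge0 //; last first.
    apply: drop; first by case/andP: u.
    move=> x /sub[xc xz]; rewrite (ltNge r) (ltNge z) (ltW (ltr' _ xc)) mz //.
    exact: ltr'.
  rewrite mulrCA; apply: mulr_ge0; first by rewrite ler0z subr_ge0 ltW.
  rewrite /W.
  rewrite (eq_dd_shifted (E' := E) (h' := h)); first exact: IH.
  move=> x; rewrite -(perm_mem p) => xc; by rewrite /shifted_below /below /= (ltNge r) (ltW (ltr' _ xc)).
(* Now [z < r < z'] are neighbours. Interpolation leaves two divided differences, each with one of
   them removed, and [drop] applies to both. *)
have [z' [z'c z'r mz']] := seq_min hgt.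
have z'c' : z' \in c'.
  by move: z'c; rewrite (perm_mem p) inE => /predU1P[e|//]; move: z'r; rewrite e ltNge ltW.
have [c'' [p' u' sub']] := seq_extract (proj2 (andP u)) z'c'.
have pp : perm_eq c [:: z, z' & c''] by rewrite (perm_trans p) // perm_cons.
have pp' : perm_eq [:: z, z' & c''] [:: z', z & c''].
  exact: (permEl (perm_catCA [:: z] [:: z'] c'')).
have uu : uniq [:: z, z' & c''] by rewrite -(perm_uniq pp).
have uu' : uniq [:: z', z & c''] by rewrite -(perm_uniq pp').
have zz : 0 < (z' - z)%:~R :> rat by rewrite ltr0z subr_gt0 (lt_trans zr).
have sep x : x \in c -> x != z -> (r < x) = (z < x).
  move=> xc xz; case: (ltgtP r x) => [rx|xr|e]; last by move: (neq _ xc); rewrite e eqxx.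
    by rewrite (lt_trans zr rx).
  by rewrite ltNge mz.
have sep' x : x \in c -> x != z' -> (r < x) = (z' < x).
  move=> xc xz; case: (ltgtP r x) => [rx|xr|e]; last by move: (neq _ xc); rewrite e eqxx.
    by rewrite lt_neqAle eq_sym xz mz'.
  by rewrite ltNge (ltW (lt_trans xr z'r)).
rewrite -(pmulr_rge0 _ zz) mulrCA (perm_dd _ pp) (WP _ _ _ pp) dd_interp //.
rewrite mulrDr addr_ge0 // mulrCA mulr_ge0 ?ler0z ?subr_ge0 ?(ltW zr) ?(ltW z'r) //.
  apply: drop => [|x xc]; first by case/andP: uu.
  by have [xc1 xz] := sub _ (etrans (perm_mem p' x) xc); exact: sep.
rewrite (W1P _ _ pp'); apply: drop => [|x xc]; first by case/andP: uu'.
apply: sep'; first by rewrite (perm_mem pp) (perm_mem pp') inE xc orbT.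
by case/andP: uu' => nz _; apply: contraNneq nz => <-.
Qed.

(** * Signs of the weights, and pure diagrams as divided differences *)

Lemma dd_weight_sign (c : seq int) x : 0 < (-1) ^+ below x c * dd_weight c x.
Proof.
rewrite /dd_weight /below; elim: c => [|y c IH]; first by rewrite big_nil mulr1.
rewrite big_cons /=; case: (ltgtP y x) => yx /=; last by rewrite add0n.
  rewrite add1n exprS mulrACA mulr_gt0 //.
  by rewrite mulN1r oppr_gt0 invr_lt0 ltrz0 subr_lt0.
by rewrite add0n mulrCA mulr_gt0 // invr_gt0 ltr0z subr_gt0.
Qed.

Lemma root_poly_sign (R : seq int) x : x \notin R -> 0 < (-1) ^+ below x R * root_poly R x.
Proof.
rewrite /root_poly /below; elim: R => [|y c IH]; first by rewrite big_nil mulr1.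
rewrite inE negb_or => /andP[xy /IH{}IH].
rewrite big_cons /=; case: (ltgtP y x) xy => yx // _ /=.
  by rewrite add1n exprS mulrACA mulr_gt0 // mulN1r oppr_gt0 ltrz0 subr_lt0.
by rewrite add0n mulrCA mulr_gt0 // ltr0z subr_gt0.
Qed.

Lemma root_poly_mem (R : seq int) x : x \in R -> root_poly R x = 0.
Proof.
by move=> xR; rewrite /root_poly (big_rem x) //= subrr mul0r.
Qed.

Lemma below_nth (s : seq int) i : sorted <%R s -> (i < size s)%N -> below (nth 0 s i) s = i.
Proof.
elim: s i => // y s IH i /= ps; have ss := path_sorted ps.
have /allP ms := order_path_min lt_trans ps.
rewrite /below /=; case: i => [|i] /= si.
  rewrite ltxx add0n; apply/eqP; rewrite -leqn0 leqNgt -has_count.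
  by apply/hasPn => z /ms; rewrite -leNgt => /ltW.
by rewrite ms ?mem_nth // add1n; congr _.+1; exact: IH.
Qed.

Lemma below_leq (s : seq int) i x : sorted <%R s -> (i < size s)%N ->
  (below x s <= i)%N = (x <= nth 0 s i).
Proof.
move=> ss si; have e := below_nth ss si; case: (lerP x (nth 0 s i)) => h.
  rewrite -{1}e; apply: sub_count => y /= yx; exact: lt_le_trans yx h.
by have := below_lt (mem_nth 0 si) h; rewrite e ltnNge => /negbTE.
Qed.

Lemma dd_nth f (d : seq int) :
  dd f d = \sum_(i < size d) f (nth 0 d i) * dd_weight d (nth 0 d i).
Proof. by rewrite /dd (big_nth 0) big_mkord. Qed.

Lemma pure_nth (d : seq int) i : sorted <%R d -> (i < size d)%N ->
  pure d i (nth 0 d i) = (-1) ^+ i * dd_weight d (nth 0 d i).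
Proof.
move=> sd si; rewrite /pure si eqxx /=; congr (_ * _).
rewrite /dd_weight [RHS](big_nth 0) big_mkord; apply: eq_bigl => k.
by rewrite nth_uniq ?ltn_ord // (sorted_uniq lt_trans ltxx).
Qed.

Lemma pure_eq0 (d : seq int) i j : (i < size d)%N && (j == nth 0 d i) = false -> pure d i j = 0.
Proof. by rewrite /pure => ->. Qed.

Lemma pure_gt0 (d : seq int) i : sorted <%R d -> (i < size d)%N -> 0 < pure d i (nth 0 d i).
Proof.
by move=> sd si; rewrite pure_nth // -{1}(below_nth sd si) dd_weight_sign.
Qed.

Lemma pure_ge0 (d : seq int) i j : sorted <%R d -> 0 <= pure d i j.
Proof.
move=> sd; case E : ((i < size d)%N && (j == nth 0 d i)); last by rewrite pure_eq0.
by case/andP: E => si /eqP->; rewrite ltW ?pure_gt0.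
Qed.

(** * Linear forms on diagrams, and moments *)

Definition pairing (n : nat) (M N : int) (g : nat -> int -> rat) (beta : diagram) : rat :=
  \sum_(i < n.+1) (-1) ^+ i *
    \sum_(k < (absz (N - M)).+1)
      beta i (M + i%:Z + k%:Z) * g i (M + i%:Z + k%:Z).

Lemma row_pick (M N : int) (i : nat) (f : int -> rat) (j : int) :
  M + i%:Z <= j <= N + i%:Z -> (forall j' : int, j' != j -> f j' = 0) ->
  \sum_(k < (absz (N - M)).+1) f (M + i%:Z + k%:Z) = f j.
Proof.
move=> jr f0; have kb : (absz (j - M - i%:Z)%R < (absz (N - M)%R).+1)%N by lia.
rewrite (bigD1 (Ordinal kb)) //= big1 ?addr0; last first.
  move=> k kne; apply: f0; apply: contraNneq kne => e; apply/eqP/val_inj; rewrite /= -e.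
  by have -> : M + i%:Z + k%:Z - M - i%:Z = k%:Z by ring.
by congr f; lia.
Qed.

Lemma pairingD n M N g b1 b2 (x y : rat) :
  pairing n M N g (fun i j => x * b1 i j + y * b2 i j) =
  x * pairing n M N g b1 + y * pairing n M N g b2.
Proof.
rewrite /pairing !big_distrr -big_split; apply: eq_bigr => i _ /=.
rewrite (mulrCA x) (mulrCA y) -mulrDr; congr (_ * _); rewrite !mulr_sumr -big_split.
by apply: eq_bigr => k _ /=; rewrite mulrDl !mulrA.
Qed.

Lemma pairingB n M N g b1 b2 (x : rat) :
  pairing n M N g (fun i j => b1 i j - x * b2 i j) =
  pairing n M N g b1 - x * pairing n M N g b2.
Proof.
rewrite -mulNr -[X in X + _]mul1r -pairingD /pairing; apply: eq_bigr => i _; congr (_ * _).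
by apply: eq_bigr => k _; rewrite mul1r mulNr.
Qed.

Lemma pairing_sum n M N g (C : seq (seq int)) (lam : seq int -> rat) :
  pairing n M N g (fun i j => \sum_(d <- C) lam d * pure d i j) =
  \sum_(d <- C) lam d * pairing n M N g (pure d).
Proof.
elim: C => [|c C IH].
  rewrite big_nil /pairing big1 // => i _; rewrite big1 ?mulr0 // => k _.
  by rewrite big_nil mul0r.
rewrite big_cons -IH -[X in _ + X]mul1r -pairingD.
rewrite /pairing; apply: eq_bigr => i _; congr (_ * _).
by apply: eq_bigr => k _; rewrite big_cons mul1r.
Qed.

(** The signs in [pairing] and in [pure] cancel, leaving a divided difference whose integrand may
    depend on the row. *)
Lemma pairing_pure n M N s g d : in_Ps n M N s d ->
  pairing n M N g (pure d) =
  \sum_(i < size d) g i (nth 0 d i) * dd_weight d (nth 0 d i).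
Proof.
case=> -[sd [_ dn]] [dB _].
rewrite /pairing -(big_mkord predT (fun i => (-1) ^+ i * \sum_(k < (absz (N - M)).+1)
      pure d i (M + i%:Z + k%:Z) * g i (M + i%:Z + k%:Z))) (big_cat_nat _ dn) //=.
rewrite [X in _ + X]big1_seq ?addr0 ?big_mkord.
  apply: eq_bigr => i _.
  rewrite (@row_pick M N i (fun j => pure d i j * g i j) (nth 0 d i)) ?dB //.
    by rewrite pure_nth // -mulrA signrMK mulrC.
  by move=> j /negbTE jd; rewrite pure_eq0 ?mul0r // jd andbF.
move=> i /andP[_]; rewrite mem_index_iota => /andP[di _].
by rewrite big1 ?mulr0 // => k _; rewrite pure_eq0 ?mul0r // ltnNge di.
Qed.

(** Up to the sign [(-1) ^+ m], the monomial is a [root_poly] with [m] roots at 0. *)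
Lemma moment_pure n M N s d m : in_Ps n M N s d -> (m <= codim d)%N ->
  pairing n M N (fun _ j => (j%:~R) ^+ m) (pure d) = (-1) ^+ m * (m == codim d)%:R.
Proof.
move=> dP md; rewrite (pairing_pure _ dP).
have [[sd [d0 dn]] _] := dP.
rewrite -(@dd_nth (fun x => x%:~R ^+ m)).
have -> : dd (fun x => x%:~R ^+ m) d = (-1) ^+ m * dd (root_poly (nseq m 0)) d.
  rewrite -ddZ; apply: eq_dd => x _.
  by rewrite /root_poly big_nseq iter_mulr_1 sub0r rmorphN /= (exprNn x%:~R) signrMK.
rewrite dd_const_root_poly ?size_nseq //.
exact: (sorted_uniq lt_trans ltxx).
Qed.

Lemma pure_inB n M N s d : in_Ps n M N s d -> inB n M N (pure d).
Proof.
case=> -[sd [_ dn]] [dB _] i j; case E : ((i < size d)%N && (j == nth 0 d i)).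
  by case/andP: E => si /eqP-> _; split; [lia | exact: dB].
by rewrite pure_eq0 // eqxx.
Qed.

(** * Degree sequences of varying length, indexed by all rows *)

(* The value [N + i + 1] in row [i] encodes that row [i] is dropped, so that
   lowering the codimension is also a raise of one row by one. *)
Definition ext_seq (n : nat) (M N : int) (e : nat -> int) : Prop :=
  (forall i, (i <= n)%N -> M + i%:Z <= e i <= N + i%:Z + 1) /\
  (forall i, (i < n)%N -> e i < e i.+1).

Definition ext_len (n : nat) (N : int) (e : nat -> int) : nat :=
  find (fun i : nat => N + i%:Z < e i) (iota 0 n.+1).

Definition degs (n : nat) (N : int) (e : nat -> int) : seq int :=
  mkseq e (ext_len n N e).

Section ExtendedSequences.
Variables (n : nat) (M N : int) (e : nat -> int).
Hypothesis (He : ext_seq n M N e).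

Lemma ext_len_leq : (ext_len n N e <= n.+1)%N.
Proof. by rewrite /ext_len -{2}(size_iota 0 n.+1) find_size. Qed.

(** The dropped rows form a final segment: [e i > N + i] and strict growth force
    [e i.+1 > N + i + 1]. *)
Lemma ext_len_lt i : (i <= n)%N -> (i < ext_len n N e)%N = (e i <= N + i%:Z).
Proof.
move=> ni; case: ltnP => h.
  have := before_find 0%N h; rewrite nth_iota ?ltnS // add0n => /negbT.
  by rewrite -leNgt => ->.
have [l Hl] : {l | l = ext_len n N e} by exists (ext_len n N e).
have lb : N + l%:Z < e l.
  have hs : has (fun i : nat => N + i%:Z < e i) (iota 0 n.+1).
    by rewrite has_find size_iota -/(ext_len n N e); lia.
  have := nth_find 0%N hs; rewrite -/(ext_len n N e) -Hl nth_iota //; lia.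
rewrite -Hl in h; apply/esym/negbTE; rewrite -ltNge.
elim: i ni h => [|i IH] ni h; first by have -> : 0%N = l by lia.
have [<-//|ne] := eqVneq l i.+1.
have := IH (ltnW ni) ltac:(lia); have := He.2 i ni; lia.
Qed.

Lemma ext_mono i j : (i < j <= n)%N -> e i < e j.
Proof.
elim: j => [|j IH]; first by rewrite ltn0.
case/andP; rewrite ltnS leq_eqVlt => /predU1P[->|ij] jn; first exact: He.2.
by apply: (lt_trans (IH _)); [rewrite ij ltnW|exact: He.2].
Qed.

Lemma size_degs : size (degs n N e) = ext_len n N e.
Proof. exact: size_mkseq. Qed.

Lemma nth_degs i : (i < ext_len n N e)%N -> nth 0 (degs n N e) i = e i.
Proof. by move=> h; rewrite nth_mkseq. Qed.

Lemma degs_sorted : sorted <%R (degs n N e).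
Proof.
apply/(sortedP 0) => i; rewrite size_degs => il.
have il' := ltnW il; rewrite !nth_degs //; apply: He.2.
have := ext_len_leq; lia.
Qed.

Lemma degs_in_Ps : (0 < ext_len n N e)%N -> in_Ps n M N 0 (degs n N e).
Proof.
move=> l0; split; [split; [exact: degs_sorted | by rewrite size_degs ext_len_leq]|split=> //].
move=> i; rewrite size_degs => il; rewrite nth_degs //.
have := ext_len_leq; have ni : (i <= n)%N by have := ext_len_leq; lia.
by move: il; rewrite ext_len_lt // => ->; have := He.1 i ni => /andP[->].
Qed.

(** The bound on [x] makes this hold in dropped rows too, where both sides are true. *)
Lemma below_degs i x : (i <= n)%N -> x <= N + i%:Z ->
  (below x (degs n N e) <= i)%N = (x <= e i).
Proof.
move=> ni xN; case: (ltnP i (ext_len n N e)) => h.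
  by rewrite below_leq ?size_degs ?degs_sorted // nth_degs.
have -> : (below x (degs n N e) <= i)%N.
  by apply: leq_trans h; rewrite -size_degs count_size.
move: h; rewrite leqNgt ext_len_lt // -ltNge => h; apply/esym; lia.
Qed.

Lemma mem_degs i : (i <= n)%N -> e i <= N + i%:Z -> e i \in degs n N e.
Proof.
by move=> ni; rewrite -ext_len_lt // => il; rewrite -nth_degs // mem_nth // size_degs.
Qed.
End ExtendedSequences.

Lemma ext_len_anti n M N e E : ext_seq n M N e -> ext_seq n M N E ->
  (forall i, (i <= n)%N -> e i <= E i) -> (ext_len n N E <= ext_len n N e)%N.
Proof.
move=> He HE le; case: leqP => // h.
have ln : (ext_len n N e <= n)%N by have := ext_len_leq n N E; lia.
move: (h); rewrite (ext_len_lt HE) // => h2.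
have : (ext_len n N e < ext_len n N e)%N by rewrite {2}/ext_len -/(ext_len n N e) (ext_len_lt He) // (le_trans (le _ ln)).
by rewrite ltnn.
Qed.

Lemma degs_le n M N e E : ext_seq n M N e -> ext_seq n M N E ->
  (forall i, (i <= n)%N -> e i <= E i) -> pure_le (degs n N e) (degs n N E).
Proof.
move=> He HE le; have ll := ext_len_anti He HE le.
split; first by rewrite !size_degs.
move=> i; rewrite size_degs => il; rewrite !nth_degs ?(leq_trans il) //; apply: le.
have := ext_len_leq n N E; lia.
Qed.

(** * Linear forms attached to corners *)

(* From [E] one can only go up in [E] by raising row [k + 1] before row [k]; the
   element in between is a boundary facet of the fan, and [corner_form] is
   proportional to its coefficient. *)
Definition corner (n : nat) (M N : int) (E : nat -> int) (k : nat) : Prop :=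
  [/\ ext_seq n M N E, (k.+1 < ext_len n N E)%N & E k.+1 = E k + 1].

Definition corner_roots (n : nat) (N : int) (E : nat -> int) (k : nat) : seq int :=
  [seq r <- degs n N E | (r != E k) && (r != E k.+1)].

Definition corner_form (n : nat) (N : int) (E : nat -> int) (k i : nat) (j : int) : rat :=
  (j <= E i)%R%:R * root_poly (corner_roots n N E k) j.

Lemma perm_corner n M N E k : corner n M N E k ->
  perm_eq (degs n N E) (corner_roots n N E k ++ [:: E k; E k + 1]).
Proof.
case=> HE kE ek.
have ud : uniq (degs n N E) by rewrite (sorted_uniq lt_trans ltxx) // (degs_sorted HE).
have mk i : (i < ext_len n N E)%N -> E i \in degs n N E.
  by move=> il; rewrite -(nth_degs il) mem_nth // size_degs.
apply: uniq_perm => //.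
  rewrite cat_uniq filter_uniq //= !mem_filter -ek !eqxx !andbF /= inE andbT.
  by apply/eqP => h; move: ek; rewrite -h; lia.
move=> x; rewrite mem_cat mem_filter -ek !inE.
have [->|xk] /= := eqVneq x (E k); first by rewrite mk // ltnW.
have [->|xk1] /= := eqVneq x (E k.+1); first by rewrite mk.
by rewrite orbF.
Qed.

(** On a pure diagram the truncation [j <= E i] is a comparison of ranks, so this is
    [dd_shifted_sign] with [a = E k] and [h = 0]. *)
Lemma corner_form_pure_ge0 n M N s E k c : corner n M N E k -> in_Ps n M N s c ->
  0 <= pairing n M N (corner_form n N E k) (pure c).
Proof.
move=> HE cP; rewrite (pairing_pure _ cP); case: cP => -[sc [_ cn]] [cB _].
have := @dd_shifted_sign (E k) (corner_roots n N E k) c 0.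
rewrite expr0 mul1r (sorted_uniq lt_trans ltxx) // => /(_ isT).
rewrite dd_nth; congr (0 <= _); apply: eq_bigr => i _; rewrite /corner_form; congr (_%:R * _ * _).
rewrite /shifted_below addn0 -(perm_below _ (perm_corner HE)) (below_nth sc) //.
case: HE => HE _ _; rewrite (below_degs HE) //; first by have := ltn_ord i; lia.
by case/andP: (cB i (ltn_ord i)).
Qed.

(** Below [E] the truncation is void, and a polynomial of degree [ext_len n N E - 2] is too small
    for at least [ext_len n N E] nodes. *)
Lemma corner_form_pure_eq0 n M N E k e : corner n M N E k -> ext_seq n M N e ->
  (forall i, (i <= n)%N -> e i <= E i) ->
  pairing n M N (corner_form n N E k) (pure (degs n N e)) = 0.
Proof.
move=> HE He le; have [HE1 kE _] := HE; have ll := ext_len_anti He HE1 le.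
have e0 : (0 < ext_len n N e)%N by apply: leq_trans ll; exact: leq_trans kE.
rewrite (pairing_pure _ (degs_in_Ps He e0)).
have ps := perm_size (perm_corner HE).
rewrite size_cat /= size_degs addn2 in ps.
transitivity (dd (root_poly (corner_roots n N E k)) (degs n N e)).
  rewrite dd_nth; apply: eq_bigr => i _; rewrite /corner_form.
  have il : (i < ext_len n N e)%N by rewrite -size_degs.
  rewrite nth_degs // le ?mul1r //; have := ext_len_leq n N e; lia.
rewrite dd_const_root_poly ?size_degs //; try lia.
  by case: eqP => //; lia.
by rewrite (sorted_uniq lt_trans ltxx) // (degs_sorted He).
Qed.

(** * The greedy decomposition *)

Definition raise (e : nat -> int) (k i : nat) : int := if i == k then e i + 1 else e i.

Definition raisable (n : nat) (N : int) (e : nat -> int) (k : nat) : bool :=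
  [&& (k <= n)%N, e k <= N + k%:Z & (k == n) || (e k + 1 < e k.+1)].

Lemma raise_ext n M N e k : ext_seq n M N e -> raisable n N e k -> ext_seq n M N (raise e k).
Proof.
move=> [He1 He2] /and3P[kn ek kk]; split=> i ni; rewrite /raise.
  have := He1 i ni; case: eqP => [->|]; lia.
have := He2 i ni; case: eqP => [ik|_]; case: eqP => [ik1|_]; try lia.
by move: kk; rewrite -ik; case: eqP => [|_ /=]; lia.
Qed.

Lemma le_raise e k i : e i <= raise e k i.
Proof. by rewrite /raise; case: eqP => // _; rewrite lerDl. Qed.

(* On diagrams lying above the raised sequence, only the inner corner itself
   survives: all other entries of the form are cut off or hit a root. *)
Lemma corner_form_raised n M N e k (beta : diagram) : corner n M N e k ->
  (forall i j, beta i j != 0 -> (i <= n)%N /\ raise e k.+1 i <= j <= N + i%:Z) ->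
  0 <= pairing n M N (corner_form n N e k) beta -> 0 <= beta k (e k).
Proof.
move=> HC supp; have [He kl ek] := HC; have ln := ext_len_leq n N e.
have kn : (k < n.+1)%N by lia.
have row i j : (i <= n)%N -> (i != k) || (j != e k) -> beta i j * corner_form n N e k i j = 0.
  move=> ni ij; have [->|/supp[_ /andP[rj jN]]] := eqVneq (beta i j) 0; first by rewrite mul0r.
  rewrite /corner_form; case: (lerP j (e i)) => [je|]; last by rewrite mul0r mulr0.
  have ei : j = e i by apply/eqP; rewrite eq_le je (le_trans (le_raise e k.+1 i)).
  have ik1 : i != k.+1.
    by apply/eqP => ik; move: rj; rewrite ei /raise ik eqxx; lia.
  have ik : i != k.
    by case/orP: ij => //; apply: contraNneq => <-; rewrite ei.
  rewrite root_poly_mem ?mulr0 // mem_filter ei (mem_degs He) -?ei // andbT ei.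
  have lti a b : (a < b <= n)%N -> e a < e b := @ext_mono _ _ _ _ He a b.
  have k1n : (k.+1 <= n)%N by lia.
  apply/andP; split.
    case: (ltngtP i k) ik => // h _.
      by rewrite lt_eqF // lti // h.
    by rewrite gt_eqF // lti // h.
  case: (ltngtP i k.+1) ik1 => // h _.
    by rewrite lt_eqF // lti // h.
  by rewrite gt_eqF // lti // h.
have -> : pairing n M N (corner_form n N e k) beta =
   (-1) ^+ k * (beta k (e k) * corner_form n N e k k (e k)).
  rewrite /pairing (bigD1 (Ordinal kn)) //= [X in _ + X]big1 ?addr0; last first.
    move=> i ik; rewrite big1 ?mulr0 // => l _; apply: row; first by rewrite -ltnS.
    by apply/orP; left; apply: contraNneq ik => ik; apply/eqP/val_inj.
  congr (_ * _); rewrite (@row_pick M N k (fun j => beta k j * corner_form n N e k k j) (e k)) //.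
    have kn' : (k <= n)%N by rewrite -ltnS.
    by have /andP[-> _] := He.1 k kn'; rewrite -(ext_len_lt He) // ltnW.
  by move=> j jk; rewrite row // jk orbT.
rewrite mulrCA /corner_form lexx mul1r.
have nr : e k \notin corner_roots n N e k by rewrite mem_filter eqxx.
(* The two entries missing from the roots are not below [e k], so exactly [k] roots are, and the
   sign of [root_poly] cancels [(-1) ^+ k]. *)
have bk : below (e k) (corner_roots n N e k) = k.
  have := perm_below (e k) (perm_corner HC).
  rewrite -{1}(@nth_degs n N e k) ?(ltnW kl) // (below_nth (degs_sorted He)) ?size_degs ?(ltnW kl) //.
  by rewrite /below count_cat /= ltxx ltNge lerDl /= !addn0.
by rewrite pmulr_lge0 // -{1}bk root_poly_sign.
Qed.

(** Every condition passes to nonnegative combinations, which is how convexity enters. The entry at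
    [e k] of a row that is not raisable carries no sign condition; [inv_corner] supplies it once the
    row is freed. *)
Record greedy_inv (n : nat) (M N : int) (e : nat -> int) (beta : diagram) : Prop := GreedyInv {
  inv_supp : forall i j, beta i j != 0 -> (i <= n)%N /\ e i <= j <= N + i%:Z;
  inv_above : forall i j, e i < j -> 0 <= beta i j;
  inv_raisable : forall k, raisable n N e k -> 0 <= beta k (e k);
  inv_corner : forall E k, corner n M N E k -> (forall i, (i <= n)%N -> e i <= E i) ->
    0 <= pairing n M N (corner_form n N E k) beta }.

Lemma greedy_step n M N e beta : ext_seq n M N e -> (0 < ext_len n N e)%N ->
  greedy_inv n M N e beta ->
  exists k (lam : rat), [/\ raisable n N e k, 0 <= lam &
    greedy_inv n M N (raise e k) (fun i j => beta i j - lam * pure (degs n N e) i j)].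
Proof.
move=> He e0 [supp above rais corn]; have ln := ext_len_leq n N e.
set d := degs n N e; have sd : sorted <%R d := degs_sorted He.
have dP := degs_in_Ps He e0.
have top : ((ext_len n N e).-1 < n.+1)%N by lia.
(* The last row not dropped is always raisable, since a next row exceeds [N] plus its index; hence
   the minimum of [ratio] is over a nonempty set. *)
have rtop : raisable n N e (Ordinal top).
  rewrite /raisable /= -ltnS top /= -(ext_len_lt He) // prednK // leqnn /=.
  have [//|ne] := eqVneq (ext_len n N e).-1 n; rewrite /=.
  have ln' : (ext_len n N e <= n)%N by lia.
  have := @ext_len_lt _ _ _ _ He _ ln'; have tn : ((ext_len n N e).-1 <= n)%N by lia.
  have := @ext_len_lt _ _ _ _ He _ tn; rewrite prednK // leqnn ltnn; lia.
pose ratio k := beta k (e k) / pure d k (e k).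
case: (@arg_minP _ _ _ (Ordinal top) (fun k : 'I_n.+1 => raisable n N e k) (fun k => ratio k) rtop).
move=> k rk mink; exists k, (ratio k).
have pos i : (i <= n)%N -> e i <= N + i%:Z -> 0 < pure d i (e i).
  move=> ni; rewrite -(ext_len_lt He) // => il.
  by rewrite -(nth_degs il) pure_gt0 // size_degs.
have p0 i j : j != e i -> pure d i j = 0.
  move=> ji; rewrite pure_eq0 // size_degs; case: ltnP => //= il.
  by rewrite (nth_degs il); exact: negbTE.
have l0 : 0 <= ratio k.
  by have /and3P[kn ek _] := rk; rewrite divr_ge0 ?rais // ltW ?pos.
have supp' i j : beta i j - ratio k * pure d i j != 0 ->
    (i <= n)%N /\ raise e k i <= j <= N + i%:Z.
  have [-> | ji] := eqVneq j (e i); last first.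
    rewrite p0 // mulr0 subr0 => /supp[ni /andP[ej jN]]; split=> //; rewrite jN andbT.
    by rewrite /raise; case: eqP; lia.
  have [ik|ik] := eqVneq i (k : nat).
    have /and3P[kn ek _] := rk.
    by rewrite ik /ratio divfK ?subrr ?eqxx // gt_eqF // pos.
  move=> nz; rewrite /raise (negbTE ik) lexx /=.
  have [b0|/supp[ni /andP[_ ->]]//] := eqVneq (beta i (e i)) 0.
  have : pure d i (e i) != 0 by apply: contraNneq nz => ->; rewrite b0 mulr0 subr0.
  by case/(pure_inB dP) => ni /andP[_ ->].
(* Corner forms at any [E] above [e] vanish on the subtracted pure diagram, so their values do not
   change. *)
have corn' E l : corner n M N E l -> (forall i, (i <= n)%N -> e i <= E i) ->
    0 <= pairing n M N (corner_form n N E l) (fun i j => beta i j - ratio k * pure d i j).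
  by move=> CE le; rewrite pairingB (corner_form_pure_eq0 CE He le) mulr0 subr0; exact: corn.
split=> //; split=> //.
- move=> i j rj; have ej := le_lt_trans (le_raise e k i) rj.
  by rewrite p0 ?gt_eqF // mulr0 subr0 above.
- move=> l; have [-> _|lk rl] := eqVneq l (k : nat).
    rewrite /raise eqxx p0 ?mulr0 ?subr0 ?above ?ltrDl //.
    by rewrite gt_eqF // ltrDl.
  have rle : raise e k l = e l by rewrite /raise (negbTE lk).
  rewrite rle; case: (boolP (raisable n N e l)) => [rl'|nrl].
    have /and3P[ln' el _] := rl'; have ln1 : (l < n.+1)%N by [].
    have := mink (Ordinal ln1) rl'; rewrite /ratio /= => mn.
    by rewrite subr_ge0 -ler_pdivlMr // pos.
  (* Row [l] has just become raisable, so row [l + 1] left the position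
     [e l + 1]: this is an inner corner of [e]. *)
  have [lk1 ekl] : (k : nat) = l.+1 /\ e l.+1 = e l + 1.
    move: rl nrl; rewrite /raisable rle => /and3P[ln' el]; rewrite ln' el /=.
    have [//|ne] := eqVneq l n; rewrite /= /raise.
    have := He.2 l; case: eqP => [<-|_] h1 h2 h3; lia.
  apply: (@corner_form_raised n M N e l (fun i j => beta i j - ratio k * pure d i j)).
  + split=> //; rewrite -lk1 (ext_len_lt He) //; by case/and3P: rk.
  + by move=> i j /supp'; rewrite lk1.
  + apply: corn' => //; split=> //; rewrite -lk1 (ext_len_lt He) //; by case/and3P: rk.
- by move=> E l CE le; apply: corn' => // i ni; exact: le_trans (le_raise e k i) (le i ni).
Qed.

Lemma greedy_decomposition n M N e beta : ext_seq n M N e -> greedy_inv n M N e beta ->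
  exists (C : seq (seq int)) (lam : seq int -> rat),
    [/\ uniq C,
        (forall c, c \in C -> exists E, [/\ ext_seq n M N E, (0 < ext_len n N E)%N,
           (forall i, (i <= n)%N -> e i <= E i) & c = degs n N E]),
        (forall c c', c \in C -> c' \in C -> pure_le c c' \/ pure_le c' c),
        (forall c, 0 <= lam c) &
        (forall i j, beta i j = \sum_(c <- C) lam c * pure c i j)].
Proof.
(* The measure is the distance to the sequence with entries [N + i + 1], in which every row is
   dropped; each raise lowers it by one. *)
have [m] := ubnP (\sum_(i < n.+1) absz (N + i%:Z + 1 - e i)%R)%N.
elim: m e beta => // m IH e beta sm He inv.
have [l0|l0] := posnP (ext_len n N e).
  exists [::], (fun=> 0); split=> // i j; rewrite big_nil.
  apply/eqP/negPn/negP => /(inv_supp inv)[ni /andP[ej jN]].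
  have := ext_len_lt He ni; rewrite l0 ltn0; lia.
have [k [lam0 [rk lam0_ge0 inv']]] := greedy_step He l0 inv.
have He' := raise_ext He rk; have /and3P[kn ek _] := rk.
have [|C [lam [uC extC chC lam_ge0 betaE]]] := IH _ _ _ He' inv'.
  have kn1 : (k < n.+1)%N by []; move: sm; rewrite ltnS; apply: leq_trans.
  rewrite [X in (_ < X)%N](bigD1 (Ordinal kn1)) //= (bigD1 (Ordinal kn1)) //=.
  rewrite -addSn leq_add //; first by rewrite /raise eqxx; lia.
  by apply: leq_sum => i /negbTE ik; rewrite /raise -[i == k :> nat]/(i == Ordinal kn1) ik.
set d := degs n N e.
(* All later members lie above [raise e k], hence differ from [d] in row [k]. *)
have dC : d \notin C.
  apply/negP => /extC[E [HE _ le dE]].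
  have eqd : ext_len n N e = ext_len n N E by rewrite -!size_degs -/d dE.
  have kl : (k < ext_len n N e)%N by rewrite (ext_len_lt He).
  have : nth 0 d k = nth 0 (degs n N E) k by rewrite dE.
  rewrite !nth_degs -?eqd // => eE; have := le k kn; rewrite /raise eqxx eE; lia.
have dmin c : c \in C -> pure_le d c.
  move=> /extC[E [HE _ le ->]]; apply: (degs_le He HE) => i ni.
  exact: le_trans (le_raise e k i) (le i ni).
exists (d :: C), (fun c => if c == d then lam0 else lam c); split=> /=.
- by rewrite dC.
- move=> c; rewrite inE => /predU1P[->|/extC[E [HE E0 le ->]]]; first by exists e.
  by exists E; split=> // i ni; exact: le_trans (le_raise e k i) (le i ni).
- move=> c c'; rewrite !inE => /predU1P[->|cC] /predU1P[->|c'C].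
  + by left; split.
  + by left; exact: dmin.
  + by right; exact: dmin.
  + exact: chC.
- by move=> c; case: eqP.
- move=> i j; rewrite big_cons eqxx.
  rewrite (eq_big_seq (fun c => lam c * pure c i j)); last first.
    by move=> c cC; case: eqP => // cd; rewrite -cd cC in dC.
  by rewrite -betaE addrC subrK.
Qed.

(** * The fan inside the subspace, and its convexity *)

Lemma fan_inBs n M N s beta : fan n M N s beta -> inBs n M N s beta.
Proof.
case=> C [[CP _] [lam [lam0 ->]]]; split.
  move=> i j; case: (boolP (has (fun d => pure d i j != 0) (undup C))).
    by case/hasP=> d; rewrite mem_undup => /CP/pure_inB + + _ => /[apply].
  move/hasPn => h; rewrite big1_seq ?eqxx // => d /andP[_ dC].
  by have := h d dC; rewrite negbK => /eqP->; rewrite mulr0.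
move=> m ms.
rewrite -[LHS]/(pairing n M N (fun _ j => j%:~R ^+ m) _) pairing_sum big1_seq // => d.
rewrite mem_undup => /andP[_ /CP dP]; have [_ [_ sd]] := dP.
by rewrite (moment_pure dP) 1?ltn_eqF ?mulr0 // ?(leq_trans ms) // ltnW // (leq_trans ms).
Qed.

(** For the least sequence [M + i] the support condition is membership in [inB]; the inequalities
    hold on each pure diagram. *)
Lemma fan_greedy_inv n M N s beta : fan n M N s beta ->
  greedy_inv n M N (fun i => M + i%:Z) beta.
Proof.
case=> C [[CP Cch] [lam [lam0 betaE]]].
have ge0 i j : 0 <= beta i j.
  rewrite betaE big_seq sumr_ge0 // => d; rewrite mem_undup => dC.
  by rewrite mulr_ge0 ?lam0 // pure_ge0 //; have [[]] := CP d dC.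
have [inb _] : inBs n M N s beta by apply: fan_inBs; exists C; split; [split|exists lam].
split=> // E k HE _; rewrite betaE pairing_sum big_seq sumr_ge0 // => d.
by rewrite mem_undup => dC; rewrite mulr_ge0 ?lam0 // (corner_form_pure_ge0 HE (CP d dC)).
Qed.

Lemma greedy_inv_combination n M N e b1 b2 (x y : rat) : 0 <= x -> 0 <= y ->
  greedy_inv n M N e b1 -> greedy_inv n M N e b2 ->
  greedy_inv n M N e (fun i j => x * b1 i j + y * b2 i j).
Proof.
move=> x0 y0 [s1 a1 r1 c1] [s2 a2 r2 c2]; split.
- move=> i j; have [b0|/s1//] := eqVneq (b1 i j) 0.
  by have [b0'|/s2//] := eqVneq (b2 i j) 0; rewrite b0 b0' !mulr0 addr0 eqxx.
- by move=> i j ij; rewrite addr_ge0 // mulr_ge0 // ?a1 ?a2.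
- by move=> k rk; rewrite addr_ge0 // mulr_ge0 // ?r1 ?r2.
- by move=> E k CE le; rewrite pairingD addr_ge0 // mulr_ge0 // ?c1 ?c2.
Qed.

(* The moment of order [v] vanishes on diagrams of codimension > v and equals
   [(-1)^v] in codimension [v], so it isolates the coefficients of codimension [v]. *)
Lemma low_codim_coef0 n M N s C (lam : seq int -> rat) beta :
  uniq C -> (forall c, c \in C -> in_Ps n M N 0 c) -> (forall c, 0 <= lam c) ->
  (forall i j, beta i j = \sum_(c <- C) lam c * pure c i j) ->
  (forall m, (m < s)%N -> pairing n M N (fun _ j => j%:~R ^+ m) beta = 0) ->
  forall c, c \in C -> (codim c < s)%N -> lam c = 0.
Proof.
move=> uC CP lam0 betaE HK c; have [v] := ubnP (codim c).
elim: v c => // v IH c cv cC cs.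
have := HK _ cs.
have -> : beta = (fun i j => \sum_(c <- C) lam c * pure c i j).
  by do 2!apply: functional_extensionality => ?; exact: betaE.
rewrite pairing_sum.
have -> : \sum_(d <- C) lam d * pairing n M N (fun _ j => j%:~R ^+ codim c) (pure d) =
          (-1) ^+ codim c * \sum_(d <- C | codim d == codim c) lam d.
  rewrite big_distrr [RHS]big_mkcond; apply: eq_big_seq => d dC /=.
  case: (ltngtP (codim d) (codim c)) => [dc|cd|e].
  - by rewrite (IH d) ?mul0r // ?(ltn_trans dc cs) // (leq_trans dc).
  - by rewrite (moment_pure (CP d dC)) 1?ltn_eqF ?mulr0 // ltnW.
  - by rewrite (moment_pure (CP d dC)) e ?eqxx // mulr1 mulrC.
(* Only the coefficients in codimension [codim c] remain; they are nonnegative with sum zero. *)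
move/eqP; rewrite mulf_eq0 signr_eq0 /= psumr_eq0 // => /allP/(_ c cC).
by rewrite eqxx => /eqP.
Qed.

Unset Implicit Arguments.

Theorem theorem3p5 (n : nat) (M N : int) (s : nat) :
  (1 <= n)%N -> M <= N -> (s <= n)%N ->
  (forall beta : diagram, fan n M N s beta -> inBs n M N s beta) /\
  (forall (b1 b2 : diagram) (t : rat),
     fan n M N s b1 -> fan n M N s b2 -> 0 <= t -> t <= 1 ->
     fan n M N s (fun i j => t * b1 i j + (1 - t) * b2 i j)).
Proof.
move=> _ MN _; split=> [beta|b1 b2 t f1 f2 t0 t1]; first exact: fan_inBs.
set beta := fun i j => _.
have inv : greedy_inv n M N (fun i => M + i%:Z) beta.
  by apply: greedy_inv_combination (fan_greedy_inv f1) (fan_greedy_inv f2); rewrite ?subr_ge0.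
have ext0 : ext_seq n M N (fun i => M + i%:Z) by split=> i _; lia.
have [C [lam [uC extC chC lam0 betaE]]] := greedy_decomposition ext0 inv.
have CP c : c \in C -> in_Ps n M N 0 c.
  by move=> /extC[E [HE E0 _ ->]]; exact: degs_in_Ps.
have HK m : (m < s)%N -> pairing n M N (fun _ j => j%:~R ^+ m) beta = 0.
  move=> ms; rewrite pairingD.
  have [_ h1] := fan_inBs f1; have [_ h2] := fan_inBs f2.
  have := h1 m ms; have := h2 m ms; rewrite /pairing /rowsum => -> ->.
  by rewrite !mulr0 addr0.
have low := low_codim_coef0 uC CP lam0 betaE HK.
(* The greedy chain may contain members of codimension below [s]; their coefficients vanish by
   [low], so they can be discarded. *)
exists [seq c <- C | (s <= codim c)%N]; split.
  split=> [d|d d']; rewrite !mem_filter.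
    by case/andP=> sd /CP[dd [dB _]].
  by case/andP=> _ dC /andP[_ d'C]; exact: chC.
exists lam; split=> //; do 2!apply: functional_extensionality => ?.
rewrite betaE undup_id ?filter_uniq // big_filter [RHS]big_mkcond /=.
apply: eq_big_seq => c cC; case: leqP => // cs.
by rewrite low ?mul0r.
Qed.
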